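(* Let $\mathbb K$ be a field, taken as coefficients, let $X$ be a topological space, let $\mathcal U$ be a finite open covering of $X$ and let $q\ge 0$. Then the canonical maps at scale $\mathcal U$, $$H^q_{\mathcal U}(X)\to\mathrm{Hom}(H_q^{\mathcal U}(X),\mathbb K),\quad z\mapsto\Bigl(\gamma\mapsto\int_\gamma z\Bigr),$$ $$H_q^{\mathcal U}(X)\to\mathrm{Hom}(H^q_{\mathcal U}(X),\mathbb K),\quad \gamma\mapsto\Bigl(z\mapsto\int_\gamma z\Bigr),$$ are isomorphisms.
   Context: Coefficients are in $\mathbb K$. A formal $q$-simplex is an ordered tuple $\sigma=(x_0\ \ldots\ x_q)$ of points of $X$ (repetitions allowed); it is $\mathcal U$-small if all $x_i$ lie in a common element of $\mathcal U$. $S^{\mathcal U}_q(X)$ is the vector space of finite linear combinations of $\mathcal U$-small formal $q$-simplices, with boundary $\partial(x_0\ \ldots\ x_q)=\sum_{j=0}^q(-1)^j(x_0\ \ldots\ \widehat{x_j}\ \ldots\ x_q)$; $H_q^{\mathcal U}(X)$ is the $q$-th homology of this complex. $C^q(X)$ is the space of all functions $\xi\colon X^{q+1}\to\mathbb K$, with $\delta\xi(x_0,\ldots,x_{q+1})=\sum_{j=0}^{q+1}(-1)^j\xi(x_0,\ldots,\widehat{x_j},\ldots,x_{q+1})$. A cochain is $\mathcal U$-locally zero if it vanishes on all tuples contained in a single member of $\mathcal U$. $H^q_{\mathcal U}(X)$ is the cohomology of the complex $\overline C^*_{\mathcal U}(X)$ of cochains modulo $\mathcal U$-locally zero cochains.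 For $z\in H^q_{\mathcal U}(X)$ represented by $\xi$ (so $\delta\xi$ is $\mathcal U$-locally zero) and $\gamma\in H_q^{\mathcal U}(X)$ represented by a $\mathcal U$-small cycle $c=\sum k_i\sigma_i$, the integral is $\int_\gamma z:=\xi(c):=\sum k_i\xi(\sigma_i)$, where $\xi((x_0\ \ldots\ x_q)):=\xi(x_0,\ldots,x_q)$; it is well defined and bilinear. *)

(* Defs.v *)
From HB Require Import structures.
From mathcomp Require Import all_boot all_algebra ring_quotient.
From mathcomp Require Import all_classical topology.
From mathcomp Require Import finmap.
From mathcomp Require Import monalg.

Set Implicit Arguments.
Unset Strict Implicit.
Unset Printing Implicit Defensive.

Import GRing.Theory.

Local Open Scope ring_scope.
Local Open Scope quotient_scope.

Section QuotientModule.
Variables (K : fieldType) (V : lmodType K) (I : submodClosed V).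

Fact submod_oppr : oppr_closed (I : {pred V}).
Proof. by move=> x xI; rewrite -scaleN1r rpredZ. Qed.

Definition submod_zmod : zmodClosed V :=
  HB.pack (GRing.SubmodClosed.sort I) (GRing.isOppClosed.Build V I submod_oppr).

Definition quotmod := Quotient.quot submod_zmod.
HB.instance Definition _ := GRing.Zmodule.on quotmod.

Definition quot_class : V -> quotmod := \pi_(Quotient.quot submod_zmod).
Definition quot_repr : quotmod -> V := fun z => repr (z : Quotient.quot submod_zmod).

Lemma quot_reprK z : quot_class (quot_repr z) = z.
Proof. exact: reprK. Qed.

Lemma quot_classE (x y : V) : (quot_class x == quot_class y) = (x - y \in I).
Proof. by rewrite -[RHS]/(x - y \in submod_zmod) Quotient.idealrBE. Qed.

Lemma quot_reprB x : quot_repr (quot_class x) - x \in I.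
Proof. by rewrite -quot_classE quot_reprK. Qed.

Lemma quot_classD (x y : V) : quot_class (x + y) = quot_class x + quot_class y.
Proof. exact: (raddfD \pi_(Quotient.quot submod_zmod)). Qed.

Definition quot_scale (a : K) (z : quotmod) : quotmod :=
  quot_class (a *: quot_repr z).

Lemma quot_scaleE a x : quot_scale a (quot_class x) = quot_class (a *: x).
Proof. by apply/eqP; rewrite quot_classE -scalerBr rpredZ ?quot_reprB. Qed.

Fact quot_scaleA a b z : quot_scale a (quot_scale b z) = quot_scale (a * b) z.
Proof. by rewrite -[z]quot_reprK !quot_scaleE scalerA. Qed.

Fact quot_scale1 : left_id 1 quot_scale.
Proof. by move=> z; rewrite -[z]quot_reprK quot_scaleE scale1r. Qed.

Fact quot_scaleDr : right_distributive quot_scale +%R.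
Proof.
move=> a z w; rewrite -[z]quot_reprK -[w]quot_reprK -quot_classD.
by rewrite !quot_scaleE scalerDr quot_classD.
Qed.

Fact quot_scaleDl z : {morph quot_scale^~ z : a b / a + b}.
Proof.
by move=> a b; rewrite -[z]quot_reprK !quot_scaleE scalerDl quot_classD.
Qed.

HB.instance Definition _ := GRing.Zmodule_isLmodule.Build K quotmod
  quot_scaleA quot_scale1 quot_scaleDr quot_scaleDl.

Fact quot_class_linear : linear quot_class.
Proof. by move=> a x y; rewrite quot_classD -quot_scaleE. Qed.

HB.instance Definition _ :=
  GRing.isLinear.Build K V quotmod *:%R quot_class quot_class_linear.

End QuotientModule.

Arguments quot_repr {K V I} z.

Section Homology.
Variables (K : fieldType) (A B C : lmodType K).
Variables (f : {linear A -> B}) (g : {linear B -> C}).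

Definition ker_pred : {pred B} := fun x => g x == 0.

Fact ker_submod : submod_closed ker_pred.
Proof.
split=> [|a x y /eqP x0 /eqP y0]; first by rewrite unfold_in linear0.
by rewrite unfold_in linearP x0 y0 scaler0 addr0.
Qed.

HB.instance Definition _ := GRing.isSubmodClosed.Build K B ker_pred ker_submod.

Definition kernel := {x : B | x \in ker_pred}.
HB.instance Definition _ := [isSub of kernel for @sval B _].
HB.instance Definition _ := [Choice of kernel by <:].
HB.instance Definition _ := [SubChoice_isSubLmodule of kernel by <:].

Definition im_pred : {pred kernel} := fun x => `[< exists a, f a = val x >].

Fact im_submod : submod_closed im_pred.
Proof.
split=> [|a x y /asboolP[u ux] /asboolP[v vy]]; apply/asboolP.
  by exists 0; rewrite !linear0.
by exists (a *: u + v); rewrite !linearP ux vy.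
Qed.

HB.instance Definition _ :=
  GRing.isSubmodClosed.Build K kernel im_pred im_submod.

(* [ker g / im f]; the definition is total, [g \o f = 0] (which holds in the
   complexes below) not being part of the data: it is [ker g / (im f \cap
   ker g)] in general. *)
Definition homology := quotmod im_pred.
HB.instance Definition _ := GRing.Lmodule.on homology.

End Homology.

Section Dual.
Variables (K : fieldType) (V : lmodType K).

Definition linear_pred : {pred V -> K^o} := fun f => `[< linear f >].

Fact linear_pred_submod : submod_closed linear_pred.
Proof.
split=> [|c f g /asboolP fl /asboolP gl]; apply/asboolP => a u v.
  by rewrite /= scaler0 addr0.
rewrite !fctE fl gl !scalerDr !scalerA [c * a]mulrC.
by rewrite addrACA.
Qed.

HB.instance Definition _ :=
  GRing.isSubmodClosed.Build K (V -> K^o) linear_pred linear_pred_submod.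

Definition dual := {f : V -> K^o | f \in linear_pred}.
HB.instance Definition _ := [isSub of dual for @sval (V -> K^o) _].
HB.instance Definition _ := [Choice of dual by <:].
HB.instance Definition _ := [SubChoice_isSubLmodule of dual by <:].

Definition mk_dual (f : V -> K^o) (fl : linear f) : dual :=
  exist _ f (asboolT fl).

End Dual.

Definition linear_iso (K : fieldType) (V W : lmodType K) (f : V -> W) : Prop :=
  linear f /\ bijective f.

Section LinearExtension.
Variables (K : fieldType) (T : choiceType) (M : lmodType K) (f : T -> M).

Definition linear_extension (c : {malg K[T]}) : M :=
  \sum_(x <- msupp c) c@_x *: f x.

Lemma linear_extensionE (D : {fset T}) (c : {malg K[T]}) :
  (msupp c `<=` D)%fset -> linear_extension c = \sum_(x <- D) c@_x *: f x.
Proof.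
move=> cD; apply: big_fset_incl => // x _ /mcoeff_outdom ->.
by rewrite scale0r.
Qed.

Fact linear_extension_linear : linear linear_extension.
Proof.
move=> a c d; set D := (msupp c `|` msupp d)%fset.
have cD : (msupp c `<=` D)%fset by exact: fsubsetUl.
have dD : (msupp d `<=` D)%fset by exact: fsubsetUr.
have cdD : (msupp (a *: c + d) `<=` D)%fset.
  apply: fsubset_trans (msuppD_le _ _) _.
  by apply: fsetUSS => //; exact: msuppZ_le.
rewrite !(@linear_extensionE D)// scaler_sumr -big_split/=.
by apply: eq_bigr => x _; rewrite mcoeffD mcoeffZ scalerDl scalerA.
Qed.

HB.instance Definition _ := GRing.isLinear.Build K {malg K[T]} M *:%R
  linear_extension linear_extension_linear.

Lemma linear_extensionU x : linear_extension << x >> = f x.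
Proof.
rewrite (@linear_extensionE [fset x]%fset) ?msuppU_le//.
by rewrite big_seq_fset1 mcoeffUU scale1r.
Qed.

End LinearExtension.

Section Scale.
Variables (K : fieldType) (X : choiceType) (U : set (set X)).

Definition face (q : nat) (j : 'I_q.+2) (x : q.+2.-tuple X) : q.+1.-tuple X :=
  [tuple tnth x (lift j i) | i < q.+1].

Definition small (q : nat) (x : q.+1.-tuple X) : Prop :=
  exists2 A, U A & forall i, A (tnth x i).

Lemma small_face (q : nat) (j : 'I_q.+2) (x : q.+2.-tuple X) :
  small x -> small (face j x).
Proof.
by case=> A UA Ax; exists A => // i; rewrite tnth_mktuple.
Qed.

Definition small_simplex (q : nat) := {x : q.+1.-tuple X | `[< small x >]}.

Definition sface (q : nat) (j : 'I_q.+2) (s : small_simplex q.+1) :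
    small_simplex q :=
  exist _ (face j (val s)) (asboolT (small_face j (asboolW (valP s)))).

Definition chain (q : nat) := {malg K[small_simplex q]}.
HB.instance Definition _ q := GRing.Lmodule.on (chain q).

Definition boundary (q : nat) : chain q.+1 -> chain q :=
  linear_extension (fun s => \sum_(j < q.+2) (-1) ^+ j *: << sface j s >>).

HB.instance Definition _ q := GRing.Linear.on (@boundary q).

Definition null_linear (V W : lmodType K) : {linear V -> W} :=
  (\0 : V -> W).

(* Degree 0 chains are all cycles (the complex is not augmented): the zero
   module in degree -1 is replaced by a zero map. *)
Definition boundary_from (q : nat) : {linear chain q -> chain q.-1} :=
  match q with
  | 0 => null_linear (chain 0) (chain 0)
  | q'.+1 => @boundary q'
  end.

Definition small_homology (q : nat) := homology (@boundary q) (boundary_from q).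
HB.instance Definition _ q := GRing.Lmodule.on (small_homology q).

Definition cochain (q : nat) := q.+1.-tuple X -> K^o.

Definition coboundary (q : nat) (xi : cochain q) : cochain q.+1 :=
  fun x => \sum_(j < q.+2) (-1) ^+ j * xi (face j x).

Fact coboundary_linear q : linear (@coboundary q).
Proof.
move=> a xi eta; apply/funext => x.
rewrite /coboundary !fctE scaler_sumr -big_split /=.
by apply: eq_bigr => j _; rewrite mulrDr scalerAr.
Qed.

HB.instance Definition _ q := GRing.isLinear.Build K (cochain q)
  (cochain q.+1) *:%R (@coboundary q) (@coboundary_linear q).

Definition locally_zero (q : nat) : {pred cochain q} :=
  fun xi => `[< forall x : q.+1.-tuple X, small x -> xi x = 0 >].

Lemma locally_zeroP q (xi : cochain q) :
  reflect (forall x, small x -> xi x = 0) (xi \in @locally_zero q).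
Proof. exact: asboolP. Qed.

Fact locally_zero_submod q : submod_closed (@locally_zero q).
Proof.
split=> [|a xi eta /locally_zeroP xi0 /locally_zeroP eta0].
  exact/locally_zeroP.
by apply/locally_zeroP => x xs; rewrite !fctE xi0 ?eta0// scaler0 addr0.
Qed.

HB.instance Definition _ q := GRing.isSubmodClosed.Build K (cochain q)
  (@locally_zero q) (@locally_zero_submod q).

Lemma coboundary_locally_zero q (xi : cochain q) :
  xi \in @locally_zero q -> coboundary xi \in @locally_zero q.+1.
Proof.
move=> /locally_zeroP xi0; apply/locally_zeroP => x xs.
by rewrite /coboundary big1// => j _; rewrite xi0 ?mulr0//; exact: small_face.
Qed.

(* A prefix [s] marks cochains modulo the locally zero ones. *)
Definition scochain (q : nat) := quotmod (@locally_zero q).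

Definition scoboundary (q : nat) (z : scochain q) : scochain q.+1 :=
  quot_class _ (coboundary (quot_repr z)).

Lemma scoboundaryE q (xi : cochain q) :
  scoboundary (quot_class _ xi) = quot_class _ (coboundary xi).
Proof.
apply/eqP; rewrite quot_classE -linearB; apply: coboundary_locally_zero.
exact: quot_reprB.
Qed.

Fact scoboundary_linear q : linear (@scoboundary q).
Proof.
move=> a z w; rewrite -[z]quot_reprK -[w]quot_reprK -linearP.
by rewrite !scoboundaryE !linearP.
Qed.

HB.instance Definition _ q := GRing.isLinear.Build K (scochain q)
  (scochain q.+1) *:%R (@scoboundary q) (@scoboundary_linear q).

(* As for chains, the zero module in degree -1 is replaced by a zero map. *)
Definition coboundary_to (q : nat) : {linear scochain q.-1 -> scochain q} :=
  match q with
  | 0 => null_linear (scochain 0) (scochain 0)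
  | q'.+1 => @scoboundary q'
  end.

Definition small_cohomology (q : nat) :=
  homology (coboundary_to q) (@scoboundary q).
HB.instance Definition _ q := GRing.Lmodule.on (small_cohomology q).

Definition eval_chain (q : nat) (xi : cochain q) (c : chain q) : K^o :=
  linear_extension (fun s : small_simplex q => xi (val s)) c.

Fact eval_chain_linear q (xi : cochain q) : linear (@eval_chain q xi).
Proof. exact: linear_extension_linear. Qed.

HB.instance Definition _ q xi := GRing.isLinear.Build K (chain q) K^o *:%R
  (@eval_chain q xi) (@eval_chain_linear q xi).

Lemma eval_chainPl q (a : K) (xi eta : cochain q) (c : chain q) :
  eval_chain (a *: xi + eta) c = a *: eval_chain xi c + eval_chain eta c.
Proof.
rewrite /eval_chain /linear_extension scaler_sumr -big_split/=.
apply: eq_bigr => s _; rewrite !fctE scalerDr !scalerA.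
by rewrite [c@_s * a]mulrC.
Qed.

Lemma eval_chain_locally_zero q (xi : cochain q) (c : chain q) :
  xi \in @locally_zero q -> eval_chain xi c = 0.
Proof.
move=> /locally_zeroP xi0; rewrite /eval_chain /linear_extension big1// => s _.
by rewrite xi0 ?scaler0//; exact: asboolW (valP s).
Qed.

Lemma eval_coboundary q (xi : cochain q) (c : chain q.+1) :
  eval_chain (coboundary xi) c = eval_chain xi (boundary c).
Proof.
rewrite {1}/eval_chain {1}/linear_extension.
rewrite /boundary {1}/linear_extension linear_sum; apply: eq_bigr => s _.
rewrite linearZ/=; congr (_ *: _); rewrite linear_sum; apply: eq_bigr => j _.
by rewrite linearZ/= /eval_chain linear_extensionU.
Qed.

Definition cocycle_repr (q : nat) (z : small_cohomology q) : cochain q :=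
  quot_repr (val (quot_repr z)).

Definition cycle_repr (q : nat) (g : small_homology q) : chain q :=
  val (quot_repr g).

(* By [integral_class] below, the value does not depend on the
   representatives. *)
Definition integral (q : nat) (g : small_homology q) (z : small_cohomology q) :
    K^o :=
  eval_chain (cocycle_repr z) (cycle_repr g).

Lemma eval_cochain_eq q (xi eta : cochain q) (c : chain q) :
  quot_class (@locally_zero q) xi = quot_class (@locally_zero q) eta ->
  eval_chain xi c = eval_chain eta c.
Proof.
move=> /eqP; rewrite quot_classE => xie.
have xe := eval_chain_locally_zero c xie.
have -> : xi = 1 *: (xi - eta) + eta by rewrite scale1r subrK.
by rewrite eval_chainPl xe scaler0 add0r.
Qed.

Lemma integral_class q (c : kernel (boundary_from q))
    (w : kernel (@scoboundary q)) (xi : cochain q) :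
  quot_class (@locally_zero q) xi = val w ->
  integral (quot_class _ c) (quot_class _ w) = eval_chain xi (val c).
Proof.
move=> xiw.
set z : small_cohomology q := quot_class _ w.
set g : small_homology q := quot_class _ c.
have xi_cocycle : coboundary xi \in @locally_zero q.+1.
  have /eqP : scoboundary (val w) == 0 := valP w.
  rewrite -xiw scoboundaryE => /eqP.
  by rewrite -[X in _ == X](linear0 (quot_class (@locally_zero q.+1)))
    quot_classE subr0.
have -> : integral g z = eval_chain xi (cycle_repr g).
  have : quot_repr z - w \in @im_pred _ _ _ _ (coboundary_to q) (@scoboundary q).
    exact: quot_reprB.
  move=> /asboolP[a]; rewrite linearB/= => aE.
  have cyc : boundary_from q (cycle_repr g) = 0 := eqP (valP (quot_repr g)).
  rewrite /integral; have zE : quot_class (@locally_zero q) (cocycle_repr z) =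
      coboundary_to q a + val w by rewrite aE subrK quot_reprK.
  move: (cycle_repr g) cyc => c'; clear -xiw zE.
  case: q a w xi z xiw zE c' => [|q] a w xi z xiw zE c' cyc.
    apply: eval_cochain_eq; rewrite zE xiw.
    by rewrite add0r.
  rewrite -(@eval_cochain_eq _ (1 *: coboundary (quot_repr a) + xi)).
    by rewrite eval_chainPl eval_coboundary cyc linear0 scaler0 add0r.
  by rewrite scale1r linearD/= xiw zE.
have : quot_repr g - c \in @im_pred _ _ _ _ (@boundary q) (boundary_from q).
  exact: quot_reprB.
move=> /asboolP[b]; rewrite linearB/= => bE.
have -> : cycle_repr g = boundary b + val c by rewrite bE subrK.
by rewrite linearD/= -eval_coboundary eval_chain_locally_zero// add0r.
Qed.

Fact integral_linear_l q (z : small_cohomology q) :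
  linear (fun g : small_homology q => integral g z).
Proof.
move=> a g h; rewrite -[g]quot_reprK -[h]quot_reprK -linearP.
rewrite -[z]quot_reprK !(integral_class _ (quot_reprK (val (quot_repr z)))).
by rewrite !linearP.
Qed.

Fact integral_linear_r q (g : small_homology q) :
  linear (fun z : small_cohomology q => integral g z).
Proof.
move=> a z w; rewrite -[z]quot_reprK -[w]quot_reprK -linearP -[g]quot_reprK.
rewrite !(integral_class _ (quot_reprK (val (quot_repr _)))).
rewrite (@integral_class _ _ _ (a *: cocycle_repr z + cocycle_repr w)).
  exact: eval_chainPl.
by rewrite !linearP/= /cocycle_repr !quot_reprK.
Qed.

Definition cohomology_to_dual (q : nat) (z : small_cohomology q) :
    dual (small_homology q) :=
  mk_dual (@integral_linear_l q z).

Definition homology_to_dual (q : nat) (g : small_homology q) :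
    dual (small_cohomology q) :=
  mk_dual (@integral_linear_r q g).

End Scale.

Arguments cohomology_to_dual {K X} U q z.
Arguments homology_to_dual {K X} U q g.

(* Main.v *)
From HB Require Import structures.
Require Import Defs.
From mathcomp Require Import all_boot all_algebra.
From mathcomp Require Import all_classical topology.
From mathcomp Require Import monalg ring.

Set Implicit Arguments.
Unset Strict Implicit.
Unset Printing Implicit Defensive.

Import GRing.Theory.

Local Open Scope ring_scope.

(** Modulo locally zero cochains, a [q]-cochain is the same thing as a linear
functional on [U]-small [q]-chains ([linear_evalP]), and the coboundary is the
transpose of the boundary.  So the first map is the universal coefficient map
over a field.  What makes it an isomorphism is that functionals on a subspace
extend to the whole space, used in the form of [functional_factor]: a
functional vanishing on the kernel of a linear map factors through that map.
Applied to the inclusion of the cycles it gives surjectivity; applied to the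
boundary map it shows that a cocycle vanishing on all cycles is a coboundary,
which is injectivity.

For the second map, injectivity follows from the first part, since the
functionals on a vector space separate its points.  Surjectivity is where the
finiteness of the covering enters.  The space is cut by [U] into finitely many
pieces, on each of which membership in the elements of [U] is constant.  Let [p]
move every point to a representative of its piece.  As [x] and [p x] lie in
the same elements of [U], the prism operator of [p] stays within small simplices
and shows that [p] acts as the identity on cohomology ([prism_homotopy],
[cocycle_collapse]).  Hence a cohomology class vanishes as soon as a cocycle
representing it vanishes on the finitely many small simplices whose vertices
are representatives ([finite_detection]).  A functional on cohomology therefore
only depends on finitely many values of the cocycle, so it is the evaluation on
a combination [c] of these simplices; since it kills coboundaries, [c] is a
cycle, and its homology class is the required preimage
([homology_to_dual_surj]).  Working with this [c] avoids computing any
dimension. *)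

(** * Linear maps and functionals *)

Definition subspace (K : fieldType) (V : lmodType K) (M : set V) :=
  M 0 /\ forall (k : K) u w, M u -> M w -> M (k *: u + w).

(** By Zorn's lemma there is a subspace maximal among those that contain [N]
and avoid [v0]; adjoining any further vector to it captures [v0], so it is a
hyperplane complementary to the line of [v0]. *)
Lemma maximal_subspace_avoiding (K : fieldType) (V : lmodType K)
    (N : set V) (v0 : V) :
  subspace N -> ~ N v0 ->
  exists M : set V, [/\ (N `<=` M)%classic, subspace M, ~ M v0 &
    forall v, exists k, M (v - k *: v0)].
Proof.
case=> N0 Ncl Nv0.
(* The union with [N] makes the property hold for the union of the empty
   chain. *)
pose P (A : set V) := subspace (N `|` A)%classic /\ ~ (N `|` A)%classic v0.
have [|A [[[M0 Mcl] Mv0] Amax]] := @Zorn_bigcup V P.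
  move=> F FP Ftot; split; last first.
    by case=> // -[A FA Av0]; have [_] := FP A FA; apply; right.
  (* Two vectors of the union already lie in one member of the chain. *)
  have common u w : (N `|` \bigcup_(X in F) X)%classic u ->
      (N `|` \bigcup_(X in F) X)%classic w ->
      N u /\ N w \/ exists2 A, F A & (N `|` A)%classic u /\ (N `|` A)%classic w.
    case=> [Nu|[A FA Au]] [Nw|[B FB Bw]].
    - by left.
    - by right; exists B => //; split; [left|right].
    - by right; exists A => //; split; [right|left].
    - right; have [AB|BA] := Ftot A B FA FB.
        by exists B => //; split; right => //; exact: AB.
      by exists A => //; split; right => //; exact: BA.
  split=> [|k u w /common /[apply] -[[Nu Nw]|[A FA [Au Aw]]]]; first by left.
    by left; exact: Ncl.
  have [[_ Acl] _] := FP A FA.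
  by have [NA|AA] := Acl k u w Au Aw; [left|right; exists A].
set M := (N `|` A)%classic in M0 Mcl Mv0.
have MZ k u : M u -> M (k *: u).
  by move=> Mu; rewrite -[_ *: u]addr0; exact: Mcl.
exists M; split=> //; first by move=> v Nv; left.
move=> v; have [Mv|nMv] := pselect (M v).
  by exists 0; rewrite scale0r subr0.
(* [B] is the span of [M] and [v]; maximality forces it to contain [v0]. *)
pose B : set V :=
  [set m | exists2 m0, M m0 & exists k, m = m0 + k *: v]%classic.
have MB : (M `<=` B)%classic.
  by move=> m Mm; exists m => //; exists 0; rewrite scale0r addr0.
have NB : (N `|` B = B)%classic.
  by apply/seteqP; split=> [m [Nm|//]|m]; [apply: MB; left|right].
have AB : (A `<` B)%classic.
  split; last first.
    move=> BA; apply: nMv; right; apply: BA; exists 0 => //.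
    by exists 1; rewrite scale1r add0r.
  by move=> m Am; apply: MB; right.
have /not_andP[Bncl|/contrapT] := Amax B AB.
  exfalso; apply: Bncl; rewrite NB; split; first exact: MB.
  move=> k _ _ [m Mm [i ->]] [m' Mm' [i' ->]].
  exists (k *: m + m'); first exact: Mcl.
  by exists (k * i + i'); rewrite scalerDr scalerDl scalerA addrACA.
rewrite NB => -[m Mm [k v0E]].
have k0 : k != 0.
  by apply/eqP => k0; apply: Mv0; rewrite v0E k0 scale0r addr0.
exists k^-1; rewrite v0E scalerDr scalerA mulVf// scale1r opprD addrCA subrr.
by rewrite addr0 -scaleNr; exact: MZ.
Qed.

(** If [phi x0 = 1], then [a x0] avoids the image under [a] of the kernel of
[phi]; projecting onto the line of [a x0] along a maximal subspace that contains
this image and avoids [a x0] gives the factorization. *)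
Lemma functional_factor (K : fieldType) (A V : lmodType K)
    (a : {linear A -> V}) (phi : {linear A -> K^o}) :
  (forall x, a x = 0 -> phi x = 0) ->
  exists psi : {linear V -> K^o}, forall x, psi (a x) = phi x.
Proof.
move=> phi0.
have [[x1 phix1]|phi_null] := pselect (exists x, phi x <> 0); last first.
  exists (null_linear V K^o) => x; apply: esym; apply: contrapT => phix.
  by apply: phi_null; exists x.
pose x0 := (phi x1)^-1 *: x1.
have phix0 : phi x0 = 1.
  by rewrite linearZ; apply: mulVf; exact/eqP.
pose N : set V := [set v | exists2 x, phi x = 0 & a x = v]%classic.
have [||M [NM [M0 Mcl] Mv0 decomp]] := @maximal_subspace_avoiding K V N (a x0).
- split; first by exists 0; rewrite ?linear0.
  move=> k _ _ [x x_0 <-] [y y_0 <-].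
  by exists (k *: x + y); rewrite linearP// x_0 y_0 scaler0 addr0.
- case=> x phix /eqP; rewrite -subr_eq0 -linearB => /eqP /phi0 /eqP.
  by rewrite linearB phix phix0 sub0r oppr_eq0 oner_eq0.
have uniq_coef v k l : M (v - k *: a x0) -> M (v - l *: a x0) -> k = l.
  move=> Mk Ml; apply: contrapT => /eqP; rewrite -subr_eq0 => kl; apply: Mv0.
  have := Mcl (k - l)^-1 _ _ (Mcl (-1) _ _ Mk Ml) M0.
  by rewrite addr0 scaleN1r opprB addrA subrK -scalerBl scalerA mulVf// scale1r.
pose psi v : K^o := sval (cid (decomp v)).
have psiP v : M (v - psi v *: a x0) := svalP (cid (decomp v)).
have psi_linear : linear psi.
  move=> k u w; apply: (uniq_coef (k *: u + w)) => //.
  have -> : k *: u + w - (k *: psi u + psi w) *: a x0 =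
      k *: (u - psi u *: a x0) + (w - psi w *: a x0).
    by rewrite scalerDl scalerBr scalerA opprD addrACA.
  exact: Mcl.
pose psi_lin : {linear V -> K^o} :=
  HB.pack psi (GRing.isLinear.Build K V K^o *:%R psi psi_linear).
exists psi_lin => x /=.
apply: (uniq_coef (a x)) => //; apply: NM; exists (x - phi x *: x0).
  rewrite linearB linearZ phix0 /= [_ *: _]mulr1 subrr//.
by rewrite linearB linearZ.
Qed.

Lemma malgU_scale (K : fieldType) (T : choiceType) (a : K) (s : T) :
  << a *g s >> = a *: << s >>.
Proof. by apply/malgP => t; rewrite mcoeffZ !mcoeffU mulr_natr. Qed.

Lemma dual_linear (K : fieldType) (V : lmodType K) (f : dual V) :
  linear (val f).
Proof. by apply/asboolP; exact: (valP f). Qed.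

Lemma dual0 (K : fieldType) (V : lmodType K) (f : dual V) : val f 0 = 0.
Proof.
have := dual_linear f (-1) 0 0.
by rewrite !scaleN1r oppr0 addr0 addNr.
Qed.

Lemma linear_inj (K : fieldType) (V W : lmodType K) (f : V -> W) :
  linear f -> (forall z, f z = 0 -> z = 0) -> injective f.
Proof.
move=> fl f0 z w zw; apply/eqP; rewrite -subr_eq0; apply/eqP/f0.
by rewrite -scaleN1r addrC fl zw scaleN1r addNr.
Qed.

Lemma bij_of_inj_surj (T T' : Type) (f : T -> T') :
  injective f -> (forall y, exists x, f x = y) -> bijective f.
Proof.
move=> finj fsurj; exists (fun y => sval (cid (fsurj y))) => [x|y].
  by apply: finj; exact: svalP (cid (fsurj (f x))).
exact: svalP (cid (fsurj y)).
Qed.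

(** * The prism operator on cochains of lists *)

Section ListCochains.
Variables (K : comPzRingType) (X : eqType) (p : X -> X).
Implicit Types (xi eta : seq X -> K) (s t : seq X).

(** On lists of all lengths, the boundary satisfies
[d (x :: s) = s - x :: d s], and the prism satisfies
[P (x :: s) = x :: p x :: map p s - x :: P s].  These recursions, read on
cochains, replace alternating sums over positions: the identities below
become inductions on the list.  The empty list makes the complex
augmented. *)
Fixpoint seq_coboundary xi s : K :=
  if s is x :: s' then xi s' - seq_coboundary (fun t => xi (x :: t)) s' else 0.

Fixpoint prism xi s : K :=
  if s is x :: s'
  then xi (x :: p x :: map p s') - prism (fun t => xi (x :: t)) s' else 0.

Lemma seq_coboundaryB xi eta s :
  seq_coboundary (fun t => xi t - eta t) s =
  seq_coboundary xi s - seq_coboundary eta s.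
Proof.
elim: s xi eta => [|x s IHs] xi eta /=; first by rewrite subr0.
by rewrite IHs; ring.
Qed.

Lemma prismB xi eta s :
  prism (fun t => xi t - eta t) s = prism xi s - prism eta s.
Proof.
elim: s xi eta => [|x s IHs] xi eta /=; first by rewrite subr0.
by rewrite IHs; ring.
Qed.

Lemma seq_coboundary_map xi s :
  seq_coboundary xi (map p s) = seq_coboundary (fun t => xi (map p t)) s.
Proof. by elim: s xi => //= x s IHs xi; rewrite IHs. Qed.

Lemma seq_coboundary_square xi s : seq_coboundary (seq_coboundary xi) s = 0.
Proof.
elim: s xi => //= x s IHs xi.
by rewrite seq_coboundaryB IHs subr0 subrr.
Qed.

(** The terms [x :: p x :: d (map p s)] and [P s] occur in both composites with
opposite signs.  What is left is [p x :: map p s - x :: map p s] and the identity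
for [s] with [x] prepended. *)
Lemma prism_homotopy xi s :
  seq_coboundary (prism xi) s + prism (seq_coboundary xi) s =
  xi (map p s) - xi s.
Proof.
elim: s xi => [|x s IHs] xi; first by rewrite /= addr0 subrr.
rewrite /= seq_coboundaryB prismB seq_coboundary_map.
have /eqP := IHs (fun t => xi (x :: t)); rewrite eq_sym subr_eq => /eqP ->.
ring.
Qed.

(** All the vertices in the prism over [s] are vertices of [s] or their images,
so the prism stays in every [p]-stable set that contains [s]. *)
Lemma prism_local (A : set X) xi s : (forall x, A x -> A (p x)) ->
  (forall t, size t = (size s).+1 -> (forall x, x \in t -> A x) -> xi t = 0) ->
  (forall x, x \in s -> A x) -> prism xi s = 0.
Proof.
move=> pA; elim: s xi => //= x s IHs xi xi0 sA.
have sA' y : y \in s -> A y by move=> ys; apply: sA; rewrite inE ys orbT.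
have xA : A x by apply: sA; rewrite mem_head.
rewrite xi0/= ?size_map//; last first.
  move=> y; rewrite !inE => /or3P[/eqP->//|/eqP->|/mapP[z zs ->]].
    exact: pA.
  by apply/pA/sA'.
rewrite sub0r IHs ?oppr0// => t ts tA; apply: xi0; rewrite /= ?ts// => y.
by rewrite inE => /predU1P[->//|]; exact: tA.
Qed.

Definition delete (j : nat) s := take j s ++ drop j.+1 s.

Lemma seq_coboundaryE xi s :
  seq_coboundary xi s = \sum_(j < size s) (-1) ^+ j * xi (delete j s).
Proof.
elim: s xi => [|x s IHs] xi; first by rewrite big_ord0.
rewrite /= big_ord_recl expr0 mul1r /delete /= drop0 IHs -sumrN.
by congr (_ + _); apply: eq_bigr => j _; rewrite exprS mulN1r mulNr.
Qed.

End ListCochains.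

Lemma val_face (X : choiceType) (q : nat) (j : 'I_q.+2) (x : q.+2.-tuple X) :
  face j x = delete j x :> seq X.
Proof.
have x0 := tnth x ord0.
have jx : (j < size x)%N by rewrite size_tuple.
apply: (@eq_from_nth _ x0) => [|i].
  rewrite size_tuple size_cat size_take jx size_drop size_tuple.
  by rewrite subSS subnKC// -ltnS.
rewrite size_tuple => iq.
rewrite -[i]/(nat_of_ord (Ordinal iq)) -tnth_nth tnth_mktuple (tnth_nth x0) /=.
rewrite nth_cat size_take jx /bump; case: ltnP => [ij|ji].
  by rewrite nth_take.
by rewrite nth_drop addSn subnKC.
Qed.

Lemma coboundary_seq (K : fieldType) (X : choiceType) (q : nat)
    (F : seq X -> K^o) (x : q.+2.-tuple X) :
  coboundary (fun y : q.+1.-tuple X => F y) x = seq_coboundary F x.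
Proof.
rewrite seq_coboundaryE size_tuple; apply: eq_bigr => j _.
by rewrite val_face.
Qed.

Definition seq_ext (K : fieldType) (X : choiceType) (q : nat)
    (xi : cochain K X q) (s : seq X) : K^o :=
  if insub s is Some y then xi y else 0.

Lemma seq_extE (K : fieldType) (X : choiceType) (q : nat)
    (xi : cochain K X q) :
  xi = fun y : q.+1.-tuple X => seq_ext xi y.
Proof. by apply/funext => y; rewrite /seq_ext valK. Qed.

(** * Cochains as functionals on chains *)

Section SmallDuality.
Variables (K : fieldType) (X : choiceType) (U : set (set X)).

Lemma homology_class_eq0 (A B C : lmodType K) (f : {linear A -> B})
    (g : {linear B -> C}) (w : kernel g) :
  (exists a, f a = val w) <-> quot_class (@im_pred _ _ _ _ f g) w = 0.
Proof.
rewrite -(linear0 (quot_class (@im_pred _ _ _ _ f g))); split.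
  by move=> aw; apply/eqP; rewrite quot_classE subr0; apply/asboolP.
by move=> /eqP; rewrite quot_classE subr0 => /asboolP.
Qed.

Lemma scochain_eq0 q (xi : cochain K X q) :
  quot_class (@locally_zero K X U q) xi = 0 <-> forall x, small U x -> xi x = 0.
Proof.
rewrite -(linear0 (quot_class (@locally_zero K X U q))); split.
  by move=> /eqP; rewrite quot_classE subr0 => /locally_zeroP.
by move=> xi0; apply/eqP; rewrite quot_classE subr0; apply/locally_zeroP.
Qed.

Lemma simplex_small q (s : small_simplex U q) : small U (val s).
Proof. exact: asboolW (valP s). Qed.

Lemma eval_chainU q (xi : cochain K X q) (s : small_simplex U q) :
  eval_chain xi << s >> = xi (val s).
Proof. exact: linear_extensionU. Qed.

Lemma linear_chainE (M : lmodType K) q (f : {linear chain K U q -> M})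
    (c : chain K U q) :
  f c = linear_extension (fun s => f << s >>) c.
Proof.
rewrite {1}[c]monalgE linear_sum; apply: eq_bigr => s _.
by rewrite -linearZ /= -malgU_scale.
Qed.

(** The small simplices form a basis of the chains, so a functional is given
by its values on them, extended by zero to the other tuples. *)
Lemma linear_evalP q (f : {linear chain K U q -> K^o}) :
  exists xi : cochain K X q, forall c, eval_chain xi c = f c.
Proof.
exists (fun x => if insub x is Some s then f << s >> else 0) => c.
rewrite [RHS]linear_chainE; congr (linear_extension _ c).
by apply/funext => s; rewrite valK.
Qed.

Lemma eval_chain_eq0 q (c : chain K U q) :
  (forall xi : cochain K X q, eval_chain xi c = 0) -> c = 0.
Proof.
move=> c0; apply/malgP => s; rewrite mcoeff0.
have sl : linear (fun c : chain K U q => c@_s : K^o).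
  by move=> a u v; rewrite mcoeffD mcoeffZ.
pose f : {linear chain K U q -> K^o} := HB.pack
  (fun c : chain K U q => c@_s : K^o)
  (GRing.isLinear.Build K (chain K U q) K^o *:%R _ sl).
by have [xi xiE] := linear_evalP f; rewrite -[LHS]/(f c) -xiE c0.
Qed.

Lemma coboundary_coboundary q (xi : cochain K X q) :
  coboundary (coboundary xi) = 0.
Proof.
rewrite [xi]seq_extE; set F := seq_ext xi.
apply/funext => x; have -> : coboundary (fun y : q.+1.-tuple X => F y) =
    fun y : q.+2.-tuple X => seq_coboundary F y.
  by apply/funext => y; rewrite coboundary_seq.
by rewrite coboundary_seq seq_coboundary_square.
Qed.

(** Cochains separate chains, so this is dual to the vanishing of the square
of the coboundary. *)
Lemma boundary_boundary q (c : chain K U q.+1) :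
  boundary_from K U q (boundary c) = 0.
Proof.
case: q c => [|q] c //; apply: eval_chain_eq0 => xi.
rewrite /= -!eval_coboundary coboundary_coboundary.
by rewrite eval_chain_locally_zero// rpred0.
Qed.

Lemma cocycle_mem q (xi : cochain K X q) :
  (forall x, small U x -> coboundary xi x = 0) ->
  quot_class (@locally_zero K X U q) xi \in ker_pred (@scoboundary K X U q).
Proof.
move=> xi0; apply/eqP; rewrite /=.
have -> := scoboundaryE U xi.
exact/scochain_eq0.
Qed.

Lemma cocycle_coboundary q (w : kernel (@scoboundary K X U q)) x :
  small U x -> coboundary (quot_repr (val w)) x = 0.
Proof.
have /eqP : scoboundary (val w) == 0 := valP w.
by move=> /scochain_eq0; exact.
Qed.

(** * Integration identifies cohomology with the dual of homology *)

(** Extend the functional from the cycles to all the chains: the extension is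
the evaluation of a cochain, which is a cocycle because boundaries represent
zero in homology. *)
Lemma cohomology_to_dual_surj q (f : dual (small_homology K U q)) :
  exists z, cohomology_to_dual U q z = f.
Proof.
pose phi (c : kernel (boundary_from K U q)) : K^o := val f (quot_class _ c).
have phil : linear phi by move=> a c d; rewrite /phi linearP (dual_linear f).
pose phiL : {linear kernel (boundary_from K U q) -> K^o} :=
  HB.pack phi (GRing.isLinear.Build K _ K^o *:%R phi phil).
have [|psi psiE] := @functional_factor K _ _
  (val : {linear kernel (boundary_from K U q) -> _}) phiL.
  by move=> c c0; have -> : c = 0 by [exact: val_inj]; exact: linear0.
have [xi xiE] := linear_evalP psi.
have xi_cocycle x : small U x -> coboundary xi x = 0.
  move=> xs; pose s : small_simplex U q.+1 := exist _ x (asboolT xs).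
  rewrite -[x]/(val s) -eval_chainU eval_coboundary xiE.
  pose b : kernel (boundary_from K U q) :=
    exist _ (boundary << s >>) (introT eqP (boundary_boundary _)).
  rewrite -[boundary _]/(val b) psiE /= /phi.
  have /homology_class_eq0 -> : exists a, @boundary K X U q a = val b.
    by exists << s >>.
  exact: dual0.
pose w : kernel (@scoboundary K X U q) :=
  exist (fun z => z \in @ker_pred _ _ _ _) _ (cocycle_mem xi_cocycle).
exists (quot_class _ w); apply/val_inj/funext => g /=.
rewrite -[g]quot_reprK (@integral_class _ _ _ _ _ _ xi)// xiE.
exact: psiE.
Qed.

Lemma cohomology_to_dual_linear q : linear (@cohomology_to_dual K X U q).
Proof.
by move=> a z w; apply/val_inj/funext => g; exact: (integral_linear_r g).
Qed.

(** A cocycle whose integrals vanish kills the kernel of the boundary map, so it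
factors through that map; the factor is a primitive of it. *)
Lemma cohomology_to_dual_inj q : injective (@cohomology_to_dual K X U q).
Proof.
apply: linear_inj; first exact: cohomology_to_dual_linear.
move=> z; rewrite -[z]quot_reprK; set w := quot_repr z => z0.
pose xi := quot_repr (val w).
have xi_cycle c : boundary_from K U q c = 0 -> eval_chain xi c = 0.
  move=> c0.
  pose c' : kernel (boundary_from K U q) := exist _ c (introT eqP c0).
  rewrite -[c]/(val c') -(integral_class c' (quot_reprK (val w))).
  by have := congr1 (fun f => val f (quot_class _ c')) z0.
have [psi psiE] := functional_factor xi_cycle.
apply/homology_class_eq0.
move: w @xi z0 xi_cycle psi psiE; case: q z => [|q] z w xi z0 xi_cycle psi psiE.
  (* In degree 0 every chain is a cycle. *)
  exists 0; rewrite linear0 -[val w]quot_reprK; apply/esym/scochain_eq0 => x xs.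
  rewrite -[x]/(val (exist _ x (asboolT xs) : small_simplex U 0)) -eval_chainU.
  by rewrite -[X in eval_chain X]/xi -psiE linear0.
have [eta etaE] := linear_evalP psi.
exists (quot_class _ eta); rewrite /= scoboundaryE -[val w]quot_reprK.
apply/eqP; rewrite quot_classE; apply/locally_zeroP => x xs.
pose s : small_simplex U q.+1 := exist _ x (asboolT xs).
apply/eqP; rewrite subr_eq0 -[x]/(val s) -!eval_chainU eval_coboundary.
by rewrite etaE psiE.
Qed.

(** * Integration embeds homology in the dual of cohomology *)

Lemma homology_to_dual_linear q : linear (@homology_to_dual K X U q).
Proof.
by move=> a g h; apply/val_inj/funext => z; exact: (integral_linear_l z).
Qed.

(** A nonzero class has value 1 under some functional, and that functional
is integration of a cohomology class. *)
Lemma homology_to_dual_inj q : injective (@homology_to_dual K X U q).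
Proof.
apply: linear_inj; first exact: homology_to_dual_linear.
move=> g g0; apply: contrapT => /eqP gN0.
have spanl : linear (fun k : K^o => k *: g).
  by move=> a k l; rewrite scalerDl scalerA.
pose span : {linear K^o -> small_homology K U q} :=
  HB.pack (fun k : K^o => k *: g)
    (GRing.isLinear.Build K K^o (small_homology K U q) *:%R _ spanl).
have [|f fE] := @functional_factor K _ _ span (idfun : {linear K^o -> K^o}).
  by move=> k /= /eqP; rewrite scaler_eq0 (negbTE gN0) orbF => /eqP.
have [z zE] := cohomology_to_dual_surj (mk_dual (linearP f)).
have : integral g z = 1.
  rewrite -[LHS]/(val (cohomology_to_dual U q z) g) zE /=.
  by have := fE 1; rewrite /= scale1r.
have -> : integral g z = 0.
  by rewrite -[LHS]/(val (homology_to_dual U q g) z) g0.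
by move=> /eqP; rewrite eq_sym oner_eq0.
Qed.

(** The coboundaries test whether a chain is a cycle, because evaluating one of
them is evaluating its primitive on the boundary. *)
Lemma cycle_of_eval q (c : chain K U q) :
  (forall (w : kernel (@scoboundary K X U q)) (xi : cochain K X q),
     quot_class _ xi = val w -> (exists a, coboundary_to K U q a = val w) ->
     eval_chain xi c = 0) ->
  boundary_from K U q c = 0.
Proof.
case: q c => [//|q] c c0; apply: eval_chain_eq0 => eta.
have cocycle x : small U x -> coboundary (coboundary eta) x = 0.
  by rewrite coboundary_coboundary.
pose w : kernel (@scoboundary K X U q.+1) :=
  exist (fun z => z \in @ker_pred _ _ _ _) _ (cocycle_mem cocycle).
rewrite /= -eval_coboundary; apply: (c0 w) => //.
by exists (quot_class _ eta); exact: scoboundaryE.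
Qed.

(** The chains [e i] need not be cycles: it is enough that the values on them
detect whether a cocycle is a coboundary.  A functional on cohomology then
factors through these values, hence is the evaluation on a combination of the
[e i], and [cycle_of_eval] shows that this combination is a cycle. *)
Lemma homology_to_dual_surj q (I : finType) (e : I -> chain K U q) :
  (forall w : kernel (@scoboundary K X U q),
     (forall i, eval_chain (quot_repr (val w)) (e i) = 0) ->
     quot_class _ w = 0 :> small_cohomology K U q) ->
  forall Phi : dual (small_cohomology K U q),
    exists g, homology_to_dual U q g = Phi.
Proof.
move=> e_detects Phi.
pose ev (w : kernel (@scoboundary K X U q)) : {ffun I -> K^o} :=
  [ffun i => eval_chain (quot_repr (val w)) (e i)].
have evE (w : kernel (@scoboundary K X U q)) (xi : cochain K X q) i :
    quot_class _ xi = val w -> ev w i = eval_chain xi (e i).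
  by move=> xiw; rewrite ffunE; apply: eval_cochain_eq; rewrite quot_reprK.
have evl : linear ev.
  move=> a v w; apply/ffunP => i.
  rewrite (evE _ (a *: quot_repr (val v) + quot_repr (val w))).
    by rewrite eval_chainPl !ffunE.
  by rewrite !linearP /= !quot_reprK.
pose evL : {linear kernel (@scoboundary K X U q) -> {ffun I -> K^o}} :=
  HB.pack ev (GRing.isLinear.Build K _ {ffun I -> K^o} *:%R ev evl).
pose phi (w : kernel (@scoboundary K X U q)) : K^o := val Phi (quot_class _ w).
have phil : linear phi by move=> a v w; rewrite /phi linearP (dual_linear Phi).
pose phiL : {linear kernel (@scoboundary K X U q) -> K^o} :=
  HB.pack phi (GRing.isLinear.Build K _ K^o *:%R phi phil).
have [|psi psiE] := @functional_factor K _ _ evL phiL.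
  move=> w /= ev0; rewrite /phi e_detects ?dual0// => i.
  by have := congr1 (fun v : {ffun I -> K^o} => v i) ev0; rewrite !ffunE.
pose delta i : {ffun I -> K^o} := [ffun j => (i == j)%:R].
pose c : chain K U q := \sum_i psi (delta i) *: e i.
have cE (w : kernel (@scoboundary K X U q)) (xi : cochain K X q) :
    quot_class _ xi = val w -> eval_chain xi c = phi w.
  move=> xiw; rewrite -[phi w]psiE.
  have -> : evL w = \sum_i ev w i *: delta i.
    apply/ffunP => j; rewrite sum_ffunE (bigD1 j)//= !ffunE eqxx.
    rewrite big1 ?addr0; first by rewrite -[_ *: _]/(_ * _) mulr1.
    move=> i ij; rewrite !ffunE (negbTE ij) scaler0//.
  rewrite !linear_sum; apply: eq_bigr => i _.
  by rewrite !linearZ /= -(evE w)//; exact: mulrC.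
have c_cycle : boundary_from K U q c = 0.
  apply: cycle_of_eval => w xi xiw /homology_class_eq0 w0.
  by rewrite (cE w)// /phi w0 dual0.
pose c' : kernel (boundary_from K U q) := exist _ c (introT eqP c_cycle).
exists (quot_class _ c'); apply/val_inj/funext => z /=.
rewrite -[z]quot_reprK (integral_class _ (quot_reprK (val (quot_repr z)))).
by rewrite (cE (quot_repr z))//; exact: quot_reprK.
Qed.

(** * Detecting cocycles on finitely many simplices *)

Section Collapse.
Variables (p : X -> X) (pU : forall A x, U A -> A x -> A (p x)).

Lemma small_map q (x : q.+1.-tuple X) : small U x -> small U (map_tuple p x).
Proof. by case=> A UA Ax; exists A => // i; rewrite tnth_map; exact: pU. Qed.

Definition map_simplex q (s : small_simplex U q) : small_simplex U q :=
  exist _ (map_tuple p (val s)) (asboolT (small_map (simplex_small s))).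

(** For a cocycle vanishing on the image of [p], two terms of the homotopy
formula disappear on small simplices, and the third one exhibits the prism, up
to sign, as a primitive. *)
Lemma cocycle_collapse q (w : kernel (@scoboundary K X U q)) :
  (forall s, eval_chain (quot_repr (val w)) << map_simplex s >> = 0) ->
  quot_class _ w = 0 :> small_cohomology K U q.
Proof.
move=> w0; pose xi := quot_repr (val w); pose F := seq_ext xi.
have FE : xi = fun y : q.+1.-tuple X => F y by exact: seq_extE.
have xiE x : small U x -> xi x = - seq_coboundary (prism p F) x.
  move=> xs; have := prism_homotopy p F x.
  have -> : F (map p x) = 0.
    rewrite -[map p x]/(val (map_tuple p x)) /F /seq_ext valK.
    by rewrite -(w0 (exist _ x (asboolT xs))) eval_chainU.
  have -> : F x = xi x by rewrite FE.
  have [A UA Ax] := xs.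
  rewrite (@prism_local K X p A (seq_coboundary F)) ?addr0 ?sub0r => [->||t|y].
  - by rewrite opprK.
  - by move=> y; exact: pU.
  - rewrite size_tuple => /eqP ts tA.
    rewrite -[t]/(val (Tuple ts)) -coboundary_seq -FE.
    apply: cocycle_coboundary; exists A => // i; apply: tA; exact: mem_tnth.
  - by move=> /tnthP[i ->].
apply/homology_class_eq0; move: w @xi w0 @F FE xiE.
case: q => [|q] w xi w0 F FE xiE.
  (* In degree 0 the only remaining term is the prism over the empty list. *)
  exists 0; rewrite linear0 -[val w]quot_reprK; apply/esym/scochain_eq0 => x xs.
  rewrite -/xi xiE//; case: x {xs} => -[|x [|? ?]]//= _.
  by rewrite !subr0 oppr0.
pose eta : cochain K X q := fun y => prism p F y.
exists (quot_class _ (- eta)).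
rewrite /= scoboundaryE -[val w]quot_reprK.
apply/eqP; rewrite quot_classE; apply/locally_zeroP => x xs.
rewrite linearN /= -/xi [_ x]/(- coboundary _ x - xi x) coboundary_seq.
by rewrite xiE//; exact: subrr.
Qed.

End Collapse.

(** Points with the same signature lie in the same elements of [U], and [p]
chooses one point for each signature.  A simplex collapsed by [p] depends only
on the signatures of its vertices, so there are finitely many of them. *)
Lemma finite_detection q :
  finite_set U ->
  exists (I : finType) (e : I -> chain K U q),
    forall w : kernel (@scoboundary K X U q),
     (forall i, eval_chain (quot_repr (val w)) (e i) = 0) ->
     quot_class _ w = 0 :> small_cohomology K U q.
Proof.
move=> /finite_seqP[s Us].
pose sig x : (size s).-tuple bool := [tuple `[< nth set0 s i x >] | i < size s].
have sigU A x y : sig x = sig y -> U A -> A x -> A y.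
  rewrite Us /= => xy As.
  have As' : (index A s < size s)%N by rewrite index_mem.
  have := congr1 (fun t => tnth t (Ordinal As')) xy.
  rewrite !tnth_mktuple /= nth_index// => AA Ax.
  by apply/asboolP; rewrite -AA; apply/asboolP.
pose p x := choose (fun y => sig y == sig x) x.
have sig_p x : sig (p x) = sig x.
  by apply/eqP; exact: (@chooseP _ (fun y => sig y == sig x) x (eqxx _)).
have p_sig x y : sig x = sig y -> p x = p y.
  by move=> xy; rewrite /p xy; apply: choose_id; rewrite ?xy.
have pU A x : U A -> A x -> A (p x) by move=> UA Ax; exact: (sigU A x).
exists {ffun 'I_q.+1 -> (size s).-tuple bool}.
pose sigs (x : small_simplex U q) : {ffun 'I_q.+1 -> (size s).-tuple bool} :=
  [ffun i => sig (tnth (val x) i)].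
(* A tuple of signatures that no small simplex realizes gets the zero chain. *)
exists (fun i => if pselect (exists x, sigs x = i) is left h
  then << map_simplex pU (sval (cid h)) >> else 0).
move=> w w0; apply: (cocycle_collapse (pU := pU)) => x.
have := w0 (sigs x); case: pselect => [h|]; last by case; exists x.
case: cid => /= y yx; congr (eval_chain _ << _ >> = 0).
apply/val_inj/eq_from_tnth => i /=; rewrite !tnth_map; apply: p_sig.
by have := congr1 (fun f : {ffun 'I_q.+1 -> _} => f i) yx; rewrite !ffunE.
Qed.

End SmallDuality.

Theorem proposition21 (K : fieldType) (X : topologicalType)
    (U : set (set X)) (q : nat) :
  finite_set U ->
  (forall A : set X, U A -> open A) ->
  (\bigcup_(A in U) A = [set: X])%classic ->
  linear_iso (cohomology_to_dual U q :
    small_cohomology K U q -> dual (small_homology K U q)) /\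
  linear_iso (homology_to_dual U q :
    small_homology K U q -> dual (small_cohomology K U q)).
Proof.
move=> finU _ _; split; split.
- exact: cohomology_to_dual_linear.
- apply: bij_of_inj_surj; first exact: cohomology_to_dual_inj.
  exact: cohomology_to_dual_surj.
- exact: homology_to_dual_linear.
- apply: bij_of_inj_surj; first exact: homology_to_dual_inj.
  have [I [e e_detects]] := finite_detection K q finU.
  exact: homology_to_dual_surj e_detects.
Qed.
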